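(* Distributional chaos in a sequence (SDC) and Ruelle–Takens chaos (R-T chaos) do not imply each other. That is: (i) there exist a metric space $X$ and a continuous map $f\colon X\to X$ that is SDC but not R-T chaotic; and (ii) there exist a metric space $Y$ and a continuous map $g\colon Y\to Y$ that is R-T chaotic but not SDC.
   Context: Let $(X,d)$ be a metric space and $f\colon X\to X$ continuous; $f^n$ denotes the $n$-fold iterate of $f$ and $\#$ denotes cardinality. For a strictly increasing sequence $\{q_i\}_{i\ge0}$ of positive integers, $x,y\in X$ and $t>0$ put $$F(f,x,y,t,q_i)=\liminf_{n\to\infty}\frac1n\#\{i : d(f^{q_i}(x),f^{q_i}(y))<t,\ 0\le i<n\},$$ $$F^*(f,x,y,t,q_i)=\limsup_{n\to\infty}\frac1n\#\{i : d(f^{q_i}(x),f^{q_i}(y))<t,\ 0\le i<n\}.$$ The map $f$ is distributionally chaotic in a sequence (SDC) if, for some such sequence $\{q_i\}$, there exists an uncountable subset $S\subseteq X$ such that for every pair $x,y\in S$ of distinct points, $F(f,x,y,\varepsilon,q_i)=0$ for some $\varepsilon>0$ and $F^*(f,x,y,t,q_i)=1$ for all $t>0$. The system $(X,f)$ is Ruelle–Takens chaotic (R-T chaotic) if it is point-transitive (some point of $X$ has a dense forward orbit) and sensitive (there is $\delta>0$ such that for every $x\in X$ and every neighbourhood $U$ of $x$ there exist $y\in U$ and $n\ge0$ with $d(f^n(x),f^n(y))>\delta$). *)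

(* Defs.v *)
From HB Require Import structures.
From mathcomp Require Import all_boot all_order all_algebra.
From mathcomp Require Import all_classical all_reals all_analysis.

Set Implicit Arguments.
Unset Strict Implicit.
Unset Printing Implicit Defensive.

Import Order.TTheory GRing.Theory Num.Theory.
Import numFieldNormedType.Exports.
Local Open Scope classical_set_scope.
Local Open Scope ring_scope.

(* The value at n = 0 is 0 by the convention 0^-1 = 0; it does not affect the
   limits below. *)
Definition closeness_freq (R : realType) (X : metricType R) (f : X -> X)
    (q : nat -> nat) (x y : X) (t : R) (n : nat) : R :=
  #|[pred i : 'I_n | mdist (iter (q i) f x) (iter (q i) f y) < t]|%:R / n%:R.

(* The frequencies lie in [0, 1], so the real-valued limn_inf and limn_sup are
   the true lower and upper limits. *)
Definition lower_dist (R : realType) (X : metricType R) (f : X -> X)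
    (q : nat -> nat) (x y : X) (t : R) : R :=
  limn_inf (closeness_freq f q x y t).

Definition upper_dist (R : realType) (X : metricType R) (f : X -> X)
    (q : nat -> nat) (x y : X) (t : R) : R :=
  limn_sup (closeness_freq f q x y t).

Definition SDC (R : realType) (X : metricType R) (f : X -> X) : Prop :=
  exists q : nat -> nat,
    [/\ forall i, (0 < q i)%N,
        forall i j, (i < j)%N -> (q i < q j)%N &
        exists S : set X, ~ countable S /\
          forall x y, S x -> S y -> x <> y ->
            (exists2 e : R, 0 < e & lower_dist f q x y e = 0) /\
            (forall t : R, 0 < t -> upper_dist f q x y t = 1)].

Definition point_transitive (R : realType) (X : metricType R) (f : X -> X) :
    Prop :=
  exists x : X, dense (range (fun n => iter n f x)).

Definition sensitive (R : realType) (X : metricType R) (f : X -> X) : Prop :=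
  exists2 delta : R, 0 < delta &
    forall (x : X) (U : set X), nbhs x U ->
      exists2 y, U y & exists n : nat, delta < mdist (iter n f x) (iter n f y).

Definition RT_chaotic (R : realType) (X : metricType R) (f : X -> X) : Prop :=
  point_transitive f /\ sensitive f.

(* Main.v *)
Require Import Defs.
From HB Require Import structures.
From mathcomp Require Import all_boot all_order all_algebra.
From mathcomp Require Import all_classical all_reals all_analysis.

(** Neither notion implies the other because each carries a requirement on the
    space that the other ignores: sensitivity excludes isolated points, and
    distributional chaos in a sequence needs uncountably many points. Two
    explicit spaces exploit this.

    SDC without Ruelle-Takens chaos. On R * nat take the distance that goes
    from a point to any other through a virtual centre: distinct points p, q
    lie at distance radius p + radius q with positive radii. The space is
    discrete, so every self-map is continuous and none is sensitive
    ([hedgehog_not_sensitive]). The map (x, n) |-> (x, n + 1) is injective on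
    the uncountable level n = 0, and its n-th iterate sends any two points of
    this level to points whose distance is twice the radius of level n. That
    radius is 1 during some blocks of times and 1 / (n + 1) during the other
    ones. Each block ends at the square
    of its starting time, hence fills a proportion of the elapsed time that
    tends to 1; so the frequency of close encounters has lower limit 0
    ([limn_inf_freq_eq0]) and upper limit 1 ([limn_sup_freq_eq1]), which gives
    [climb_SDC].

    Ruelle-Takens chaos without SDC. A countable space cannot be SDC, so it is
    enough to put on nat a metric for which the successor is continuous and
    sensitive; the orbit of 0 is then the whole space. Writing v for the 2-adic
    valuation, take
      d(m, n) = |m - n|_2 + |v(m + 1) - v(n + 1)|.
    The second term is locally constant for the 2-adic topology
    ([mark_periodic]), so d induces that topology, which is
    translation invariant and has no isolated point. Yet m and m + 2^k, close
    when k is large, are carried by the same iterate of the successor to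
    2^k - 1 and 2^(k+1) - 1, where the valuations differ by 1
    ([step_sensitive]). *)

Set Implicit Arguments.
Unset Strict Implicit.
Unset Printing Implicit Defensive.

Import Order.TTheory GRing.Theory Num.Theory.
Local Open Scope classical_set_scope.
Local Open Scope ring_scope.

(** * Lower and upper limits of frequencies *)

Section LimitsAlongSubsequences.
Variable R : realType.
Implicit Types (u : nat -> R) (P : pred nat).

(** Recurrence of small values makes every tail infimum equal to 0, which
    makes the sequence of infima constant. *)
Lemma limn_inf_eq0 u : (forall n, 0 <= u n) ->
  (forall e : R, 0 < e -> forall N, exists2 n, (N <= n)%N & u n <= e) ->
  limn_inf u = 0.
Proof.
move=> u_ge0 u_small; rewrite /limn_inf (_ : infs u = cst 0) ?lim_cst//.
apply/funext => N /=; apply/eqP; rewrite eq_le; apply/andP; split; last first.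
  apply: lb_le_inf; first by exists (u N), N => /=.
  by move=> _ [n _ <-].
apply/ler_addgt0Pl => e e_gt0; rewrite addr0.
have [n Nn une] := u_small e e_gt0 N.
apply: le_trans une; apply: ge_inf; last by exists n.
by exists 0 => _ [k _ <-].
Qed.

Lemma limn_sup_eq1 u : (forall n, u n <= 1) ->
  (forall e : R, 0 < e -> forall N, exists2 n, (N <= n)%N & 1 - e <= u n) ->
  limn_sup u = 1.
Proof.
move=> u_le1 u_big; rewrite /limn_sup (_ : sups u = cst 1) ?lim_cst//.
apply/funext => N /=; apply/eqP; rewrite eq_le; apply/andP; split.
  apply: ge_sup; first by exists (u N), N => /=.
  by move=> _ [n _ <-].
apply/ler_addgt0Pl => e e_gt0; rewrite -lerBlDl.
have [n Nn une] := u_big e e_gt0 N.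
apply: le_trans une _; apply: ub_le_sup; last by exists n.
by exists 1 => _ [k _ <-].
Qed.

Definition freq P (n : nat) : R := #|[pred i : 'I_n | P i]|%:R / n%:R.

Lemma freq_ge0 P n : 0 <= freq P n.
Proof. by rewrite divr_ge0. Qed.

Lemma freq_le1 P n : freq P n <= 1.
Proof.
have [->|n_gt0] := posnP n; first by rewrite /freq invr0 mulr0 ler01.
rewrite ler_pdivrMr ?ltr0n// mul1r ler_nat.
by rewrite (leq_trans (max_card _))// card_ord.
Qed.

Lemma freqC P n : (0 < n)%N -> freq (predC P) n = 1 - freq P n.
Proof.
move=> n_gt0; apply/eqP; rewrite eq_sym subr_eq addrC; apply/eqP.
rewrite /freq -mulrDl -natrD.
have -> : #|[pred i : 'I_n | predC P i]| = #|[predC [pred i : 'I_n | P i]]|.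
  by apply: eq_card.
by rewrite cardC card_ord divff// pnatr_eq0 -lt0n.
Qed.

(** Only the m indices before the block [m, n) can satisfy P. *)
Lemma freq_le P m n : (forall i, (m <= i < n)%N -> ~~ P i) ->
  freq P n <= m%:R / n%:R.
Proof.
move=> nP; rewrite ler_wpM2r ?invr_ge0// ler_nat cardE -(size_map val).
rewrite -[leqRHS](size_iota 0); apply: uniq_leq_size.
  by rewrite map_inj_uniq ?enum_uniq//; exact: val_inj.
move=> _ /mapP[i + ->]; rewrite mem_enum inE mem_iota add0n /= => Pi.
by rewrite ltnNge; apply/negP => mi; move: Pi; apply/negP/nP; rewrite mi /=.
Qed.

Lemma freq_ge P m n : (0 < n)%N -> (forall i, (m <= i < n)%N -> P i) ->
  1 - m%:R / n%:R <= freq P n.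
Proof.
move=> n_gt0 hP; rewrite lerBlDr -lerBlDl -freqC//.
by apply: freq_le => i /hP /= ->.
Qed.

End LimitsAlongSubsequences.

(** * Times of gathering and of separation *)

(** Starting times of consecutive blocks of times; each is the square of the
    preceding one, so that the past of a block is negligible at its end. *)
Definition block (k : nat) : nat := (2 ^ (2 ^ k))%N.

Lemma ltn_block k : (k < block k)%N.
Proof. by rewrite (ltn_trans (ltn_expl k _) (ltn_expl _ _)). Qed.

Lemma block_ratio (R : realType) k :
  (block k)%:R / (block k.+1)%:R = (block k)%:R^-1 :> R.
Proof.
by rewrite /block expnSr expnM -mulnn natrM invfM mulrA divff ?mul1r.
Qed.

Lemma block_inv_small (R : realType) (e : R) : 0 < e ->
  exists N : nat, forall k, (N <= k)%N -> (block k)%:R^-1 < e.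
Proof.
move=> e_gt0; have [N _ hN] := near_infty_natSinv_lt (PosNum e_gt0).
exists N => k Nk; apply: le_lt_trans (hN k Nk).
rewrite lef_pV2 ?posrE ?ltr0n ?ler_nat ?ltn_block//.
exact: leq_trans (ltn_block k).
Qed.

(** The parity of the index of the block that contains i, written as an
    iterated logarithm. *)
Definition gathered (i : nat) : bool := odd (trunc_log 2 (trunc_log 2 i)).

Lemma gathered_block k i : (block k <= i < block k.+1)%N -> gathered i = odd k.
Proof.
case/andP => ki ik; congr odd; apply: trunc_log_eq => //.
have i_gt0 : (0 < i)%N by rewrite (leq_trans _ ki)// expn_gt0.
apply/andP; split; first exact: trunc_log_max.
by rewrite -(ltn_exp2l _ _ (isT : (1 < 2)%N)) (leq_ltn_trans (trunc_logP _ _)).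
Qed.

Section Oscillation.
Variable R : realType.
Implicit Types P : pred nat.

(** At the end of a block of even index, P has failed since the block began. *)
Lemma limn_inf_freq_eq0 P : (forall i, P i -> gathered i) ->
  limn_inf (freq R P) = 0.
Proof.
move=> Pg; apply: limn_inf_eq0 => [n|e e_gt0 N]; first exact: freq_ge0.
have [M hM] := block_inv_small e_gt0.
pose k := (maxn M N).*2; have [Mk Nk] : (M <= k /\ N <= k)%N.
  rewrite /k; split; rewrite -addnn (leq_trans _ (leq_addr _ _))//.
  - by rewrite leq_max leqnn.
  - by rewrite leq_max leqnn orbT.
exists (block k.+1); first by rewrite (leq_trans Nk)// ltnW// ltnW// ltn_block.
rewrite (le_trans _ (ltW (hM k Mk)))// -block_ratio; apply: freq_le => i ki.
by apply/negP => /Pg; rewrite (gathered_block ki) odd_double.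
Qed.

(** At the end of a block of odd index that begins after M0, P has held since
    the block began. *)
Lemma limn_sup_freq_eq1 P (M0 : nat) :
  (forall i, (M0 <= i)%N -> gathered i -> P i) -> limn_sup (freq R P) = 1.
Proof.
move=> gP; apply: limn_sup_eq1 => [n|e e_gt0 N]; first exact: freq_le1.
have [M hM] := block_inv_small e_gt0.
pose k := (maxn M0 (maxn M N)).*2.+1.
have [M0k Mk Nk] : [/\ M0 <= k, M <= k & N <= k]%N.
  rewrite /k; split; rewrite leqW// -addnn (leq_trans _ (leq_addr _ _))//.
  - by rewrite leq_max leqnn.
  - by rewrite !leq_max leqnn orbT.
  - by rewrite !leq_max leqnn !orbT.
exists (block k.+1); first by rewrite (leq_trans Nk)// ltnW// ltnW// ltn_block.
apply: (@le_trans _ _ (1 - (block k)%:R / (block k.+1)%:R)).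
  by rewrite lerB// block_ratio ltW// hM.
apply: freq_ge => [|i ki]; first by rewrite expn_gt0.
apply: gP; last by rewrite (gathered_block ki) /= odd_double.
by rewrite (leq_trans M0k)// (leq_trans (ltnW (ltn_block k)))//; case/andP: ki.
Qed.

End Oscillation.

(** * A discrete space carrying distributional chaos *)

Section Hedgehog.
Variable R : realType.

Definition hedgehog : Type := (R * nat)%type.
HB.instance Definition _ := Choice.on hedgehog.

(** The predecessor matches the i-th time of observation, which is i + 1, with
    the index i that frequencies count. *)
Definition radius (p : hedgehog) : R :=
  if gathered p.2.-1 then p.2.+1%:R^-1 else 1.

Lemma radius_gt0 p : 0 < radius p.
Proof. by rewrite /radius; case: ifP => // _; rewrite invr_gt0 ltr0n. Qed.

Definition hedgehog_dist (p q : hedgehog) : R :=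
  if p == q then 0 else radius p + radius q.

Lemma hedgehog_distxx p : hedgehog_dist p p = 0.
Proof. by rewrite /hedgehog_dist eqxx. Qed.

Lemma hedgehog_dist_pos p q : hedgehog_dist p q = 0 -> p = q.
Proof.
rewrite /hedgehog_dist; case: eqP => // _ /eqP.
by rewrite gt_eqF// addr_gt0 ?radius_gt0.
Qed.

Lemma hedgehog_dist_sym p q : hedgehog_dist p q = hedgehog_dist q p.
Proof. by rewrite /hedgehog_dist eq_sym addrC. Qed.

Lemma hedgehog_dist_triangle q p s :
  hedgehog_dist p s <= hedgehog_dist p q + hedgehog_dist q s.
Proof.
have r0 x : 0 <= radius x by rewrite ltW// radius_gt0.
rewrite /hedgehog_dist; have [->|_] := eqVneq p q; first by rewrite add0r.
have [->|_] := eqVneq q s.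
  by rewrite addr0; case: ifP => // _; rewrite addr_ge0.
case: ifP => _; first by rewrite !addr_ge0.
by rewrite -addrA lerD2l addrA lerDr addr_ge0.
Qed.

HB.instance Definition _ := isMetric.Build R hedgehog
  hedgehog_distxx hedgehog_dist_pos hedgehog_dist_sym hedgehog_dist_triangle.

Lemma hedgehog_mdist (p q : hedgehog) : p != q ->
  mdist p q = radius p + radius q.
Proof. by move=> /negbTE pq; rewrite /mdist /= /hedgehog_dist pq. Qed.

(** Leaving p costs more than its radius. *)
Lemma hedgehog_discrete (p : hedgehog) : nbhs p [set p].
Proof.
apply/nbhs_ballP; exists (radius p); first exact: radius_gt0.
move=> q; rewrite ballEmdist /=; have [->//|pq] := eqVneq p q.
by rewrite hedgehog_mdist// gtrDl ltNge ltW// radius_gt0.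
Qed.

Lemma hedgehog_continuous (f : hedgehog -> hedgehog) : continuous f.
Proof.
move=> p A /nbhs_singleton Afp; apply: filterS (hedgehog_discrete p).
by move=> _ ->.
Qed.

Lemma hedgehog_not_sensitive (f : hedgehog -> hedgehog) : ~ sensitive f.
Proof.
case=> e e_gt0 /(_ (0, 0%N) _ (hedgehog_discrete _)) [_ -> [n]].
by rewrite mdistxx ltNge ltW.
Qed.

Definition climb (p : hedgehog) : hedgehog := (p.1, p.2.+1).

Lemma iter_climb n x : iter n climb (x, 0%N) = (x, n).
Proof. by elim: n => //= n ->. Qed.

Lemma climb_dist (x y : R) i : x != y ->
  mdist (iter i.+1 climb (x, 0%N)) (iter i.+1 climb (y, 0%N)) =
  if gathered i then 2 / i.+2%:R else 2.
Proof.
move=> xy; rewrite !iter_climb hedgehog_mdist.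
  rewrite /radius /=; case: ifP => _; rewrite -mulr2n // mulr2n.
  by rewrite -[2]/(1 + 1) mulrDl mul1r.
by apply: contra xy => /eqP[->].
Qed.

(** Countable sets are Lebesgue-null, whereas the line has infinite measure. *)
Lemma uncountable_reals : ~ countable [set: R].
Proof.
by move/countable_lebesgue_measure0; rewrite -set_itvNyy lebesgue_measure_itv.
Qed.

(** With the sequence of times i + 1 and the points of level 0, two points are
    at distance 2 outside the gathering times, which makes the lower
    distribution at 1 vanish; at gathering times their distance is
    2 / (i + 2), eventually below any t. *)
Lemma climb_SDC : SDC climb.
Proof.
exists succn; split=> //.
exists (range (fun x : R => (x, 0%N) : hedgehog)); split.
  rewrite (eq_countable (inj_card_eq _)); first exact: uncountable_reals.
  by move=> x y _ _ [->].
move=> _ _ [x _ <-] [y _ <-] xy'.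
have {xy'} xy : x != y by apply/eqP => xy; apply: xy'; rewrite xy.
have freqE t : closeness_freq climb succn (x, 0%N) (y, 0%N) t =
    freq R (fun i => (if gathered i then 2 / i.+2%:R else 2) < t).
  apply/funext => n; congr (_%:R / _); apply: eq_card => i.
  by rewrite !inE -(climb_dist _ xy).
split=> [|t t_gt0].
  exists 1 => //; rewrite /lower_dist freqE; apply: limn_inf_freq_eq0 => i.
  by case: ifP => // _; rewrite ltNge ler1n.
have [N _ hN] := near_infty_natSinv_lt (PosNum (divr_gt0 t_gt0 (ltr0Sn R 1))).
rewrite /upper_dist freqE; apply: (@limn_sup_freq_eq1 _ _ N) => i Ni ->.
by rewrite mulrC -ltr_pdivlMr// (hN i.+1)//= leqW.
Qed.

End Hedgehog.

(** * A countable space carrying Ruelle-Takens chaos *)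

(** A copy of nat indexed by the field in which distances take their values,
    so that the metric below is attached to this copy and not to nat. *)
Definition ruler_line (R : realType) : Type := nat.

Section Ruler.
Variable R : realType.

HB.instance Definition _ := Choice.on (ruler_line R).

(** The absolute difference; one of the two truncated terms is 0. *)
Definition gap (m n : nat) : nat := (m - n + (n - m))%N.

Lemma gapC m n : gap m n = gap n m. Proof. exact: addnC. Qed.

(** The 2-adic distance. *)
Definition dyadic (m n : nat) : R :=
  if m == n then 0 else 2 ^- logn 2 (gap m n).

Lemma dyadic_ge0 m n : 0 <= dyadic m n.
Proof. by rewrite /dyadic; case: ifP => // _; rewrite invr_ge0 exprn_ge0. Qed.

Lemma dyadicC m n : dyadic m n = dyadic n m.
Proof. by rewrite /dyadic eq_sym gapC. Qed.

Lemma dyadicS m n : dyadic m.+1 n.+1 = dyadic m n.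
Proof. by rewrite /dyadic /gap eqSS !subSS. Qed.

(** Balls are residue classes modulo powers of 2, which reduces the triangle
    inequality to transitivity of congruences. *)
Lemma dyadic_le m n k : (dyadic m n <= 2 ^- k) = (m == n %[mod 2 ^ k]).
Proof.
wlog mn : m n / (n <= m)%N => [hw|].
  by case/orP: (leq_total n m) => [/hw//|/hw]; rewrite dyadicC eq_sym.
rewrite /dyadic; have [->|m_neq_n] := eqVneq m n.
  by rewrite eqxx invr_ge0 exprn_ge0.
have gap_gt0 : (0 < m - n)%N by rewrite subn_gt0 ltn_neqAle eq_sym m_neq_n.
rewrite lef_pV2 ?posrE ?exprn_gt0// ler_eXn2l ?ltr1n//.
have /eqP nm0 : (n - m == 0)%N by rewrite subn_eq0.
by rewrite eqn_mod_dvd// pfactor_dvdn// /gap nm0 addn0.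
Qed.

Lemma dyadic_triangle n m p : dyadic m p <= dyadic m n + dyadic n p.
Proof.
have [->|mn] := eqVneq m n; first by rewrite lerDr dyadic_ge0.
have [->|np] := eqVneq n p; first by rewrite lerDl dyadic_ge0.
pose k := minn (logn 2 (gap m n)) (logn 2 (gap n p)).
have hk a b : a != b -> (k <= logn 2 (gap a b))%N -> a = b %[mod 2 ^ k].
  move=> ab kab; apply/eqP; rewrite -dyadic_le /dyadic (negbTE ab).
  by rewrite lef_pV2 ?posrE ?exprn_gt0// ler_eXn2l ?ltr1n.
have mp : dyadic m p <= 2 ^- k.
  by rewrite dyadic_le (hk m n) ?geq_minl// (hk n p) ?geq_minr.
apply: le_trans mp _; rewrite /k /minn; case: ifP => _.
  by rewrite [X in _ <= X + _]/dyadic (negbTE mn) lerDl dyadic_ge0.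
by rewrite [X in _ <= _ + X]/dyadic (negbTE np) lerDr dyadic_ge0.
Qed.

(** The ruler sequence 0, 1, 0, 2, 0, 1, 0, 3, and so on. The shift by one
    avoids 0, the only point near which the valuation is not 2-adically locally
    constant. *)
Definition mark (m : nat) : nat := logn 2 m.+1.

(** The valuations of m + 1 and n + 1 are read off, when below k, from the gcd
    with 2^k, and this gcd depends only on the class modulo 2^k. The bound on
    m makes the valuation of m + 1 less than k. *)
Lemma mark_periodic m n k : (m.+1 < 2 ^ k)%N -> m = n %[mod 2 ^ k] ->
  mark m = mark n.
Proof.
move=> mk mn; have mSn : m.+1 = n.+1 %[mod 2 ^ k].
  by apply/eqP; rewrite -(addn1 m) -(addn1 n) eqn_modDr; apply/eqP.
have lk : (mark m < k)%N.
  rewrite -(ltn_exp2l _ _ (isT : 1 < 2)%N); apply: leq_ltn_trans mk.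
  by apply: dvdn_leq => //; exact: pfactor_dvdnn.
have := congr1 (logn 2) (gcdn_modl m.+1 (2 ^ k)).
rewrite mSn gcdn_modl !logn_gcd ?expn_gt0// pfactorK//.
rewrite -/(mark m) -/(mark n) (minn_idPl (ltnW lk)) => nm.
by move: nm lk; rewrite /minn; case: ifP => // _ <-; rewrite ltnn.
Qed.

Definition ruler_dist (m n : ruler_line R) : R :=
  dyadic m n + `|(mark m)%:R - (mark n)%:R|.

Lemma ruler_distxx m : ruler_dist m m = 0.
Proof. by rewrite /ruler_dist /dyadic eqxx subrr normr0 addr0. Qed.

Lemma ruler_dist_pos m n : ruler_dist m n = 0 -> m = n.
Proof.
move/eqP; rewrite paddr_eq0 ?dyadic_ge0// => /andP[+ _].
rewrite /dyadic; have [//|_] := eqVneq m n.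
by rewrite gt_eqF// invr_gt0 exprn_gt0.
Qed.

Lemma ruler_dist_sym m n : ruler_dist m n = ruler_dist n m.
Proof. by rewrite /ruler_dist dyadicC distrC. Qed.

Lemma ruler_dist_triangle n m p :
  ruler_dist m p <= ruler_dist m n + ruler_dist n p.
Proof.
rewrite /ruler_dist addrACA lerD ?dyadic_triangle//.
exact: ler_distD.
Qed.

HB.instance Definition _ := isMetric.Build R (ruler_line R)
  ruler_distxx ruler_dist_pos ruler_dist_sym ruler_dist_triangle.

Lemma ruler_mdist (m n : ruler_line R) :
  mdist m n = dyadic m n + `|(mark m)%:R - (mark n)%:R|.
Proof. by []. Qed.

Definition step (m : ruler_line R) : ruler_line R := m.+1.

Lemma iter_step j m : iter j step m = (j + m)%N.
Proof. by elim: j => //= j ->. Qed.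

Lemma half_pow_small (e : R) m : 0 < e ->
  exists k, (m < 2 ^ k)%N /\ 2 ^- k < e.
Proof.
move=> e_gt0; have [N _ hN] := near_infty_natSinv_lt (PosNum e_gt0).
exists (maxn m N); split.
  by rewrite (leq_ltn_trans (leq_maxl m N))// ltn_expl.
apply: le_lt_trans (hN _ (leq_maxr m N)).
rewrite lef_pV2 ?posrE ?exprn_gt0// -natrX ler_nat.
exact: ltn_expl.
Qed.

Lemma step_continuous : continuous step.
Proof.
move=> m A /nbhs_ballP[e /= e_gt0 eA].
have [k [mk ke]] := half_pow_small m.+2 e_gt0.
apply/nbhs_ballP; exists (2 ^- k); first by rewrite /= invr_gt0 exprn_gt0.
move=> n; rewrite ballEmdist /= ruler_mdist => mn; apply: eA.
have dmn : dyadic m n < 2 ^- k by apply: le_lt_trans mn; rewrite lerDl.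
have mnk : m.+1 = n.+1 %[mod 2 ^ k].
  by apply/eqP; rewrite -dyadic_le dyadicS ltW.
rewrite ballEmdist /= ruler_mdist /step (mark_periodic mk mnk).
rewrite subrr normr0 addr0 dyadicS.
exact: lt_trans dmn ke.
Qed.

Lemma step_point_transitive : point_transitive step.
Proof.
exists (0%N : ruler_line R) => U [m Um] _; exists m; split=> //.
by exists m => //; rewrite iter_step addn0.
Qed.

(** Adding 2^k moves m little, but the iterate that brings m + 1 to 2^k brings
    its neighbour to 2^(k+1), where the marks are k and k + 1. *)
Lemma step_sensitive : sensitive step.
Proof.
exists 2^-1; first by rewrite invr_gt0.
move=> m U /nbhs_ballP[e /= e_gt0 eU].
have [k [mk ke]] := half_pow_small m.+1 e_gt0.
pose n : ruler_line R := (m + 2 ^ k)%N.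
have mnk : m = n %[mod 2 ^ k] by rewrite /n modnDr.
exists n.
  apply: eU; rewrite ballEmdist /= ruler_mdist (mark_periodic mk mnk).
  rewrite subrr normr0 addr0; apply: le_lt_trans ke.
  by rewrite dyadic_le; apply/eqP.
exists (2 ^ k - m.+1)%N; rewrite ruler_mdist !iter_step.
set j := (2 ^ k - m.+1)%N.
have jm : (j + m).+1 = (2 ^ k)%N by rewrite -addnS subnK// ltnW.
have jn : (j + n).+1 = (2 ^ k.+1)%N.
  by rewrite addnA -addSn jm addnn -mul2n expnS.
rewrite /mark jm jn !pfactorK// -[in k.+1%:R]natr1 opprD addrA.
rewrite subrr sub0r normrN1.
by rewrite (@lt_le_trans _ _ 1) ?lerDr ?dyadic_ge0// invf_lt1 ?ltr1n.
Qed.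

Lemma step_not_SDC : ~ SDC step.
Proof. by case=> q [_ _ [S [+ _]]]; apply; exact: (@countableP nat). Qed.

End Ruler.

Theorem theorem4 (R : realType) :
  (exists (X : metricType R) (f : X -> X),
     continuous f /\ SDC f /\ ~ RT_chaotic f) /\
  (exists (Y : metricType R) (g : Y -> Y),
     continuous g /\ RT_chaotic g /\ ~ SDC g).
Proof.
split.
  exists (hedgehog R), (@climb R); split; first exact: hedgehog_continuous.
  split; first exact: climb_SDC.
  by case=> _; exact: hedgehog_not_sensitive.
exists (ruler_line R), (@step R); split; first exact: step_continuous.
split; last exact: step_not_SDC.
by split; [exact: step_point_transitive|exact: step_sensitive].
Qed.
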